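(* Let $G$ be a finite simple graph with clique partition number $\theta(G)=k$ and clique number $\omega=\omega(G)$. Then $\varphi(G)\leq \frac{k^2\omega}{2k-1}$.
   Context: A clique partition of $G$ is a partition of $V(G)$ into subsets each inducing a complete subgraph; $\theta(G)$ is the minimum number of parts in a clique partition (equivalently $\theta(G)=\chi(\overline{G})$). $\omega(G)$ is the largest order of a complete subgraph of $G$. A $b$-coloring of $G$ with $b$ colors is a proper coloring of $V(G)$ using exactly $b$ colors such that for every color $i$ there is a vertex of color $i$ having neighbors of all the other $b-1$ colors. The $b$-chromatic number $\varphi(G)$ is the largest $b$ for which such a coloring exists. *)

(* Defs.v *)
From mathcomp Require Import all_boot.

Set Implicit Arguments.
Unset Strict Implicit.
Unset Printing Implicit Defensive.

(* A finite simple graph is a finType T of vertices with a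
   symmetric irreflexive adjacency relation e; these two properties are
   hypotheses of the statements, not of the definitions. *)

Definition is_clique (T : finType) (e : rel T) (K : {set T}) : bool :=
  [forall x in K, forall y in K, (x != y) ==> e x y].

Definition is_clique_partition (T : finType) (e : rel T) (P : {set {set T}}) :
    bool :=
  partition P [set: T] && [forall K in P, is_clique e K].

Lemma exists_clique_partition (T : finType) (e : rel T) :
  exists n, [exists P, is_clique_partition e P && (#|P| == n)].
Proof.
pose P : {set {set T}} := [set [set x] | x in [set: T]].
exists #|P|; apply/existsP; exists P; rewrite eqxx andbT.
apply/andP; split.
  apply/and3P; split.
  - rewrite /cover; apply/eqP/setP => x; rewrite inE; apply/bigcupP.
    by exists [set x]; rewrite ?inE //; apply: imset_f; rewrite inE.
  - apply/trivIsetP => A B /imsetP[x _ ->] /imsetP[y _ ->] neq.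
    by rewrite disjoints1 inE; apply: contraNN neq => /eqP->.
  - by apply/imsetP => -[x _ /setP /(_ x)]; rewrite !inE eqxx.
apply/forall_inP => _ /imsetP[x _ ->].
apply/forall_inP => y /set1P ->; apply/forall_inP => z /set1P ->.
by rewrite eqxx.
Qed.

Definition clique_partition_number (T : finType) (e : rel T) : nat :=
  ex_minn (exists_clique_partition e).

Definition clique_number (T : finType) (e : rel T) : nat :=
  \max_(K : {set T} | is_clique e K) #|K|.

Definition is_proper_coloring (T : finType) (e : rel T) (b : nat)
    (c : {ffun T -> 'I_b}) : bool :=
  [forall x, forall y, e x y ==> (c x != c y)].

Definition is_b_coloring (T : finType) (e : rel T) (b : nat)
    (c : {ffun T -> 'I_b}) : bool :=
  [&& is_proper_coloring e c,
      [forall i, exists x, c x == i]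
    & [forall i, exists x, (c x == i) &&
        [forall j, (j != i) ==> [exists y, e x y && (c y == j)]]]].

Definition has_b_coloring (T : finType) (e : rel T) (b : nat) : bool :=
  [exists c : {ffun T -> 'I_b}, is_b_coloring e c].

(* A coloring using all b colors has b <= #|T|, so bounding the range loses
   nothing. *)
Definition b_chromatic_number (T : finType) (e : rel T) : nat :=
  \max_(b < #|T|.+1 | has_b_coloring e b) b.

Lemma has_b_coloring_le (T : finType) (e : rel T) (b : nat) :
  has_b_coloring e b -> b <= b_chromatic_number e.
Proof.
move=> hb; have lebT : b < #|T|.+1.
  case/existsP: hb => c /and3P[_ /forallP surj _]; rewrite ltnS -[b]card_ord.
  have <- : #|[set c x | x in T]| = #|'I_b|.
    apply: eq_card => i; case/existsP: (surj i) => x /eqP <-.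
    by rewrite imset_f.
  exact: leq_imset_card.
exact: (@leq_bigmax_cond _ (fun i : 'I_#|T|.+1 => has_b_coloring e i)
  (fun i => nat_of_ord i) (Ordinal lebT)).
Qed.

(* Main.v *)
(* Fix a b-coloring with b colors, pick a dominating vertex of each color, and
   let a be the number of colors used exactly once.  Counting vertices gives
   2b - a <= k omega.  A vertex whose color occurs only once is adjacent to
   every other dominating vertex, so for each part K of a clique partition the
   dominating vertices that lie in K or have a singleton color form a clique;
   summing over the k parts gives b + (k - 1) a <= k omega.  Adding k - 1 times
   the first inequality to the second eliminates a. *)
Require Import Defs.
From mathcomp Require Import all_boot all_order all_algebra.
From mathcomp Require Import zify.

Set Implicit Arguments.
Unset Strict Implicit.
Unset Printing Implicit Defensive.

Import Order.TTheory GRing.Theory Num.Theory.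
Local Open Scope ring_scope.

(** Each index [i] of [A] is counted once, at the block containing [f i]; parts with empty preimage
    contribute 0. *)
Lemma sum_card_preim_partition (I T : finType) (P : {set {set T}})
    (f : I -> T) (A : {set I}) :
  partition P [set: T] -> (\sum_(K in P) #|A :&: f @^-1: K| = #|A|)%N.
Proof.
move=> /and3P[/eqP covP tiP _].
have inP x : x \in cover P by rewrite covP inE.
rewrite -sum1_card (partition_big (fun i => pblock P (f i)) (mem P)) /=.
  apply: eq_bigr => K PK; rewrite -sum1_card; apply: eq_bigl => i.
  rewrite !inE; congr (_ && _); apply/idP/eqP; first exact: def_pblock.
  by move=> <-; rewrite mem_pblock.
by move=> i _; rewrite pblock_mem.
Qed.

Lemma clique_card_le (T : finType) (e : rel T) (K : {set T}) :
  is_clique e K -> (#|K| <= clique_number e)%N.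
Proof. by move=> cK; apply: leq_bigmax_cond. Qed.

Lemma clique_partition_numberP (T : finType) (e : rel T) :
  exists2 P, is_clique_partition e P & #|P| = clique_partition_number e.
Proof.
rewrite /clique_partition_number; case: ex_minnP => n /existsP[P].
by case/andP=> cP /eqP <- _; exists P.
Qed.

Lemma card_le_clique_partition (T : finType) (e : rel T) (P : {set {set T}}) :
  is_clique_partition e P -> (#|T| <= #|P| * clique_number e)%N.
Proof.
case/andP=> partP /forall_inP cP.
rewrite -cardsT (card_partition partP) -sum_nat_const.
by apply: leq_sum => K PK; apply: clique_card_le; apply: cP.
Qed.

Definition singleton_colors (T : finType) (b : nat) (c : {ffun T -> 'I_b}) :
  {set 'I_b} := [set i | #|c @^-1: [set i]| == 1%N].

(** Every color class has at least two vertices, unless it is a singleton, whose missing unit the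
    second term supplies. *)
Lemma double_colors_le (T : finType) (b : nat) (c : {ffun T -> 'I_b}) :
  (forall i, exists x, c x = i) ->
  (2 * b <= #|T| + #|singleton_colors c|)%N.
Proof.
move=> surj.
have -> : (#|T| = \sum_i #|c @^-1: [set i]|)%N.
  rewrite -sum1_card (partition_big c predT) //=; apply: eq_bigr => i _.
  by rewrite -sum1_card; apply: eq_bigl => x; rewrite !inE.
rewrite -[#|singleton_colors c|]sum1_card [X in (_ + X)%N]big_mkcond /= -big_split /=.
rewrite mulnC -{1}[b]card_ord -sum_nat_const; apply: leq_sum => i _.
have : (0 < #|c @^-1: [set i]|)%N.
  by case: (surj i) => x cx; apply/card_gt0P; exists x; rewrite !inE cx.
by rewrite inE; move: #|_| => [|[|m]] //; rewrite addn0.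
Qed.

Definition dominating (T : finType) (e : rel T) (b : nat)
    (c : {ffun T -> 'I_b}) (f : 'I_b -> T) :=
  forall i, c (f i) = i /\ forall j, j != i -> exists2 y, e (f i) y & c y = j.

Lemma is_b_coloring_dominating (T : finType) (e : rel T) (b : nat)
    (c : {ffun T -> 'I_b}) :
  is_b_coloring e c -> exists f, dominating e c f.
Proof.
case/and3P=> _ _ /forallP dom; exists (fun i => xchoose (existsP (dom i))).
move=> i; have /andP[/eqP ci /forallP adj] := xchooseP (existsP (dom i)).
split=> // j ji; have /existsP[y /andP[ey /eqP cy]] := implyP (adj j) ji.
by exists y.
Qed.

(** The neighbor of color [j] that [f i] must have can only be [f j], the sole vertex of that
    color. *)
Lemma dominating_adj_singleton (T : finType) (e : rel T) (b : nat)
    (c : {ffun T -> 'I_b}) (f : 'I_b -> T) (i j : 'I_b) :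
  dominating e c f -> j \in singleton_colors c -> j != i -> e (f i) (f j).
Proof.
move=> dom; rewrite inE => /cards1P[x cj] ji.
have inj y : c y = j -> y = x.
  by move=> cy; apply/set1P; rewrite -cj !inE cy.
have [y ey cy] := (dom i).2 j ji.
by rewrite (inj _ (dom j).1) -(inj _ cy).
Qed.

(** The image of these colors under [f] is a clique of the same size, [f] being injective with left
    inverse [c]. *)
Lemma dominating_clique_card (T : finType) (e : rel T) (b : nat)
    (c : {ffun T -> 'I_b}) (f : 'I_b -> T) (K : {set T}) :
  symmetric e -> dominating e c f -> is_clique e K ->
  (#|f @^-1: K :|: singleton_colors c| <= clique_number e)%N.
Proof.
move=> e_sym dom cK.
rewrite -(card_imset _ (can_inj (fun i => (dom i).1))); apply: clique_card_le.
apply/forall_inP => _ /imsetP[i Di ->]; apply/forall_inP => _ /imsetP[j Dj ->].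
apply/implyP => fij; have ij : i != j by apply: contraNneq fij => ->.
case/setUP: Dj => [Kj | Sj]; last first.
  by apply: (dominating_adj_singleton dom Sj); rewrite eq_sym.
case/setUP: Di => [Ki | Si]; last first.
  by rewrite e_sym; apply: (dominating_adj_singleton dom Si).
rewrite !inE in Ki Kj.
by have /forall_inP/(_ _ Kj)/implyP/(_ fij) := forall_inP cK _ Ki.
Qed.

Lemma colors_singleton_le (T : finType) (e : rel T) (b : nat)
    (c : {ffun T -> 'I_b}) (f : 'I_b -> T) (P : {set {set T}}) :
  symmetric e -> dominating e c f -> is_clique_partition e P ->
  (b + #|P| * #|singleton_colors c| <=
     #|P| * clique_number e + #|singleton_colors c|)%N.
Proof.
move=> e_sym dom /andP[partP /forall_inP cP].
have := sum_card_preim_partition f [set: 'I_b] partP.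
under eq_bigr do rewrite setTI; rewrite cardsT card_ord => {1}<-.
(* Splitting the singleton colors over the parts as well makes
   [#|A :|: B| + #|A :&: B| = #|A| + #|B|] applicable part by part. *)
rewrite -[X in (_ <= _ + X)%N](sum_card_preim_partition f _ partP).
rewrite -!sum_nat_const -!big_split /=; apply: leq_sum => K PK.
by rewrite -cardsUI setIC leq_add2r; apply: dominating_clique_card (cP K PK).
Qed.

Lemma has_b_coloring_bound (T : finType) (e : rel T) (b : nat) :
  symmetric e -> has_b_coloring e b ->
  b%:R <= (clique_partition_number e)%:R ^+ 2 * (clique_number e)%:R
            / (2 * (clique_partition_number e)%:R - 1) :> rat.
Proof.
move=> e_sym /existsP[c bc].
have [f dom] := is_b_coloring_dominating bc.
have [P cP cardP] := clique_partition_numberP e.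
have := double_colors_le (fun i => ex_intro (fun x => c x = i) _ (dom i).1).
have := card_le_clique_partition cP.
have := colors_singleton_le e_sym dom cP.
have : (#|singleton_colors c| <= b)%N by rewrite -[leqRHS]card_ord max_card.
rewrite cardP {cardP}.
move: #|T| #|_| (clique_number e) => n a w leab.
case: (clique_partition_number e) => [|k] leba len le2b.
  (* With no parts, [n = 0] and [2 * b <= a <= b]. *)
  have -> : b = 0%N by lia.
  by rewrite expr0n !mul0r.
have -> : 2 * k.+1%:R - 1 = (2 * k + 1)%:R :> rat.
  by rewrite -natrM -[1]/(1%:R) -natrB; [congr _%:R; lia | lia].
rewrite ler_pdivlMr ?ltr0n ?addn1 // -natrX -!natrM ler_nat.
(* [k] is now one less than the number of parts: add [k] times [le2b], with [n] bounded by [len], to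
   [leba]. *)
nia.
Qed.

Theorem theorem2 (T : finType) (e : rel T) (k omega : nat)
    (e_sym : symmetric e) (e_irr : irreflexive e)
    (theta_k : clique_partition_number e = k)
    (omega_def : clique_number e = omega) :
  (b_chromatic_number e)%:R <= k%:R ^+ 2 * omega%:R / (2 * k%:R - 1) :> rat.
Proof.
rewrite -theta_k -omega_def /b_chromatic_number.
(* The bound passes to the maximum; the default value 0 of [\max] requires the right-hand side to be
   nonnegative, even when its denominator is -1. *)
elim/big_ind: _ => [|m n lem len|b]; last exact: has_b_coloring_bound.
  case: (clique_partition_number e) => [|j]; first by rewrite expr0n !mul0r.
  rewrite divr_ge0 ?mulr_ge0 ?exprn_ge0 ?ler0n // subr_ge0.
  by rewrite -natrM ler1n.
by rewrite /maxn; case: ifP.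
Qed.
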